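(* For a positive integer $g$ and a divisor $d$ of $g$, there exists a set $\mathcal{P}$ of $d$ $(g,g,g-d,d^2)$ $(g/d)$-regular PDAs that are Blackburn-compatible w.r.t. $I_g(t)$ (when the integer $t$ does not appear in any PDA in $\mathcal{P}$), and $L_{\mathcal{P},I_g}(I_d)$ is a $g$-regular $(dg,\;dg,\;dg-2d+1,\;d(2d-1))$ PDA.
   Context: Notation: $[n]=\{0,1,\dots,n-1\}$. For positive integers $K,f$, a nonnegative integer $Z$ and a finite set $\mathcal{S}$ of integers, a $(K,f,Z,\mathcal{S})$ placement delivery array (PDA) is an $f\times K$ array $P=[p_{j,k}]$ with entries in $\mathcal{S}\cup\{\ast\}$ such that: (C1) $\ast$ appears exactly $Z$ times in each column; (C2) each $s\in\mathcal{S}$ occurs at least once; (C3, Blackburn property) if two distinct cells $(j_1,k_1)$, $(j_2,k_2)$ contain the same integer then $p_{j_1,k_2}=p_{j_2,k_1}=\ast$. It is $g$-regular if each integer of $\mathcal{S}$ occurs exactly $g$ times. A number $S$ in place of the set means the integer set has $S$ elements. Blackburn compatibility: for arrays $P_0,P_1,P_\ast$ of the same size, $P_0$ and $P_1$ are Blackburn-compatible w.r.t. $P_\ast$ if, whenever $p^{(0)}_{i_1j_1}=p^{(1)}_{i_2j_2}\neq\ast$, we have $p^{(\ast)}_{i_1j_2}=p^{(\ast)}_{i_2j_1}=\ast$. A family is Blackburn-compatible w.r.t. $P_\ast$ if any two different members of the family are. $I_n(t)$ is the $n\times n$ array with integer $t$ on the main diagonal and $\ast$ elsewhere. Lifting of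 $I_d$: for $\mathcal{P}=\{P_0,\dots,P_{d-1}\}$ a family of $g\times g$ arrays, $L_{\mathcal{P},I_g}(I_d)$ is the $d\times d$ block array whose $i$-th diagonal block is $P_i$ and whose off-diagonal blocks are $I_g(t)$ with values $t$ distinct for distinct blocks and not occurring in $P_0,\dots,P_{d-1}$. *)

(* Defs.v *)
From HB Require Import structures.
From mathcomp Require Import all_boot all_order all_algebra.
From mathcomp Require Import finmap.

Set Implicit Arguments.
Unset Strict Implicit.
Unset Printing Implicit Defensive.

(* Arrays with entries in int plus the symbol * , encoded as [None]. *)
Definition array (f K : nat) := 'M[option int]_(f, K).

Section Arrays.
Variables f K : nat.
Implicit Types (P : array f K) (S : {fset int}).

Definition occ P (s : int) : nat :=
  #|[set c : 'I_f * 'I_K | P c.1 c.2 == Some s]|.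

Definition occurs P (s : int) : Prop := exists j k, P j k = Some s.

Definition blackburn P : Prop :=
  forall (j1 j2 : 'I_f) (k1 k2 : 'I_K) (s : int),
    (j1, k1) <> (j2, k2) -> P j1 k1 = Some s -> P j2 k2 = Some s ->
    P j1 k2 = None /\ P j2 k1 = None.

Record is_PDA_on (Z : nat) S P : Prop := IsPDAOn {
  PDA_K_gt0 : 0 < K;
  PDA_f_gt0 : 0 < f;
  PDA_entries : forall j k s, P j k = Some s -> s \in S;
  PDA_stars : forall k, #|[set j | P j k == None]| = Z;
  PDA_surj : forall s, s \in S -> occurs P s;
  PDA_blackburn : blackburn P
}.

Definition regular_on (g : nat) S P : Prop := forall s, s \in S -> occ P s = g.

Definition blackburn_compatible (Pstar P0 P1 : array f K) : Prop :=
  forall (i1 i2 : 'I_f) (j1 j2 : 'I_K) (s : int),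
    P0 i1 j1 = Some s -> P1 i2 j2 = Some s ->
    Pstar i1 j2 = None /\ Pstar i2 j1 = None.

Definition blackburn_family (Pstar : array f K) (I : Type)
    (P : I -> array f K) : Prop :=
  forall a b : I, a <> b -> blackburn_compatible Pstar (P a) (P b).

End Arrays.

(* [P] is a [g]-regular (K, f, Z, S) PDA, with [S] the number of integers. *)
Definition regular_PDA (g K f Z S : nat) (P : array f K) : Prop :=
  exists A : {fset int}, [/\ #|` A|%fset = S, is_PDA_on Z A P & regular_on g A P].

Arguments regular_PDA g K f Z S P : clear implicits.

Definition diag_array (n : nat) (t : int) : array n n :=
  (\matrix_(i, j) (if i == j then Some t else None))%R.

Fact lift_size (d g : nat) : \sum_(i < d) g = d * g.
Proof. by rewrite sum_nat_const card_ord. Qed.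

(* The labels of the off-diagonal blocks; the values [t i i] are irrelevant. *)
Definition lift_labels (d g : nat) (P : 'I_d -> array g g)
    (t : 'I_d -> 'I_d -> int) : Prop :=
  (forall i j i' j', i <> j -> i' <> j' -> t i j = t i' j' ->
     (i, j) = (i', j')) /\
  (forall i j k, i <> j -> ~ occurs (P k) (t i j)).

(* The lifting of I_d by the family [P] and I_g; the cast is only along
   [lift_size]. *)
Definition lift_array (d g : nat) (P : 'I_d -> array g g)
    (t : 'I_d -> 'I_d -> int) : array (d * g) (d * g) :=
  castmx (lift_size d g, lift_size d g)
    (\mxblock_(i < d, j < d)
       (if i == j then P i else diag_array g (t i j)))%R.

(* Main.v *)
(** Write g = d m and cut a g x g array into d x d blocks of size m. In [P_a]
    the block (x, y) is I_m(e(x, y)) if x <> y and I_m(e(x - a, x - a)) if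
    x = y, indices modulo d, with e injective. So all the [P_a] use the same
    d^2 integers, each m times. For a <> b, let an integer label the block
    (x, y) of [P_a] and the block (x', y') of [P_b]: either both are the same
    off-diagonal block, or both are diagonal with x - x' = a - b; in both cases
    x <> y' and x' <> y, which is the compatibility with I_g(t). In the lifting
    every integer of the [P_a] then occurs d m = g times, just like each of the
    d(d - 1) new labels. *)

Require Import Defs.
From mathcomp Require Import all_boot all_order all_algebra.
From mathcomp Require Import finmap zify.

Set Implicit Arguments.
Unset Strict Implicit.
Unset Printing Implicit Defensive.

Import GRing.Theory.

(** * Counting occurrences and stars; diagonal arrays *)

Lemma occ_sum (f K : nat) (Q : array f K) (s : int) :
  occ Q s = \sum_i \sum_j (Q i j == Some s).
Proof.
rewrite pair_bigA /occ -sum1_card big_mkcond.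
by apply: eq_bigr => c _; rewrite inE; case: (_ == _).
Qed.

Lemma stars_sum (f K : nat) (Q : array f K) (k : 'I_K) :
  #|[set j | Q j k == None]| = \sum_j (Q j k == None).
Proof.
rewrite -sum1_card big_mkcond.
by apply: eq_bigr => c _; rewrite inE; case: (_ == _).
Qed.

Lemma occ_gt0 (f K : nat) (Q : array f K) (s : int) :
  0 < occ Q s -> occurs Q s.
Proof. by case/card_gt0P=> -[j k]; rewrite inE => /eqP; exists j, k. Qed.

Lemma occ_eq0 (f K : nat) (Q : array f K) (s : int) :
  ~ occurs Q s -> occ Q s = 0.
Proof. by case: (posnP (occ Q s)) => // /occ_gt0. Qed.

Lemma diag_arrayE (n : nat) (t : int) (i j : 'I_n) :
  diag_array n t i j = if i == j then Some t else None.
Proof. exact: mxE. Qed.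

Lemma diag_array_Some (n : nat) (t s : int) (i j : 'I_n) :
  diag_array n t i j = Some s -> i = j /\ t = s.
Proof. by rewrite diag_arrayE; case: eqP => // -> [->]. Qed.

Lemma diag_array_None (n : nat) (t : int) (i j : 'I_n) :
  i <> j -> diag_array n t i j = None.
Proof. by rewrite diag_arrayE; case: eqP. Qed.

Lemma blackburn_diag_array (n : nat) (t : int) : blackburn (diag_array n t).
Proof.
move=> i1 i2 j1 j2 s neq /diag_array_Some[e1 _] /diag_array_Some[e2 _].
by split; apply: diag_array_None => e; apply: neq; congruence.
Qed.

Lemma occ_diag_array (n : nat) (t s : int) :
  occ (diag_array n t) s = n * (t == s).
Proof.
rewrite occ_sum -[n in RHS]card_ord -sum_nat_const; apply: eq_bigr => i _.
rewrite (bigD1 i) //= diag_arrayE eqxx big1 ?addn0 // => j /negPf ij.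
by rewrite diag_arrayE (eq_sym i) ij.
Qed.

Lemma stars_diag_array (n : nat) (t : int) (k : 'I_n) :
  \sum_j (diag_array n t j k == None) = n.-1.
Proof.
rewrite (bigD1 k) //= diag_arrayE eqxx /= add0n (eq_bigr (fun=> 1)).
  by rewrite sum1_card cardC1 card_ord.
by move=> j /negPf jk; rewrite diag_arrayE jk.
Qed.

(** Since the labels are distinct on [A], only the array of index [i0] contributes, through its [n]
    diagonal cells. *)
Lemma occ_diag_arrays (I : finType) (A : pred I) (n : nat) (f : I -> int)
    (i0 : I) :
  {in A &, injective f} -> A i0 ->
  \sum_(i | A i) occ (diag_array n (f i)) (f i0) = n.
Proof.
move=> f_inj Ai0; rewrite (bigD1 i0) //= occ_diag_array eqxx muln1.
rewrite big1 ?addn0 // => i /andP[Ai /eqP neq]; rewrite occ_diag_array.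
by case: eqP => [/f_inj-/(_ Ai Ai0)/neq|] //; rewrite muln0.
Qed.

(** * Arrays made of square blocks *)

Section BlockArrays.
Variables d g : nat.

(** The body has the shape of [lift_array] with arbitrary blocks, so [lift_array P t] is an instance
    by conversion. *)
Definition block_array (B : 'I_d -> 'I_d -> array g g) :
    array (d * g) (d * g) :=
  castmx (lift_size d g, lift_size d g) (\mxblock_(i < d, j < d) B i j)%R.

Definition block_index (c : 'I_d * 'I_g) : 'I_(d * g) :=
  cast_ord (lift_size d g) (@tagnat.Rank d (fun=> g) c.1 c.2).

Lemma block_arrayE B (a b : 'I_d) (i j : 'I_g) :
  block_array B (block_index (a, i)) (block_index (b, j)) = B a b i j.
Proof.
by rewrite castmxE !cast_ordK -[in RHS](mxblockK B a b) [RHS]mxE.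
Qed.

Lemma block_index_inj : injective block_index.
Proof.
case=> [a i] [b j] /cast_ord_inj /eqP; rewrite -val_eqE /= tagnat.eq_Rank.
by case/andP=> /eqP-> /eqP/val_inj->.
Qed.

Lemma block_index_bij : bijective block_index.
Proof.
by apply: inj_card_bij block_index_inj _; rewrite card_prod !card_ord.
Qed.

Lemma block_indexP (k : 'I_(d * g)) : exists a i, k = block_index (a, i).
Proof.
have [h _ hK] := block_index_bij; exists (h k).1, (h k).2.
by case: (h k) (hK k).
Qed.

Lemma occ_block_array B (s : int) :
  occ (block_array B) s = \sum_c occ (B c.1 c.2) s.
Proof.
have bij : {on [pred _ | true], bijective block_index}.
  exact: onW_bij block_index_bij.
rewrite occ_sum (reindex _ bij) /=.
under eq_bigr do rewrite (reindex _ bij) /=.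
rewrite -(pair_bigA _ (fun a b => occ (B a b) s)) /=.
rewrite -(pair_bigA _ (fun a i => \sum_c
  (block_array B (block_index (a, i)) (block_index c) == Some s))) /=.
apply: eq_bigr => a _.
under [RHS]eq_bigr do rewrite occ_sum.
rewrite [RHS]exchange_big /=; apply: eq_bigr => i _.
rewrite pair_bigA; apply: eq_bigr => -[b j] _.
by rewrite block_arrayE.
Qed.

Lemma stars_block_array B (b : 'I_d) (k : 'I_g) :
  #|[set j | block_array B j (block_index (b, k)) == None]| =
    \sum_a \sum_i (B a b i k == None).
Proof.
rewrite stars_sum pair_bigA (reindex block_index) /=; last first.
  exact: onW_bij block_index_bij.
by apply: eq_bigr => -[a i] _; rewrite block_arrayE.
Qed.

Lemma blackburn_block_array B :
  (forall a b, blackburn (B a b)) ->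
  (forall a b a' b' i j i' j' s, (a, b) <> (a', b') ->
     B a b i j = Some s -> B a' b' i' j' = Some s ->
     B a b' i j' = None /\ B a' b i' j = None) ->
  blackburn (block_array B).
Proof.
move=> Bin Bout k1 k2 l1 l2 s.
have [a [i ->]] := block_indexP k1; have [b [j ->]] := block_indexP l1.
have [a' [i' ->]] := block_indexP k2; have [b' [j' ->]] := block_indexP l2.
rewrite !block_arrayE => neq Bs Bs'.
have [[ea eb]|neqab] := (a, b) =P (a', b'); last exact: Bout neqab Bs Bs'.
by subst a' b'; apply: (Bin a b) Bs Bs' => -[ei ej]; subst; exact: neq.
Qed.

(** Common route to the PDA conditions for the cyclic family and for the lifting: stars and
    occurrences are counted block by block, and [0 < r] turns the latter count into the presence of
    every integer of [A]. *)
Lemma regular_block_array (B : 'I_d -> 'I_d -> array g g) (r Z : nat)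
    (A : {fset int}) :
  0 < d * g -> 0 < r ->
  (forall a b i j s, B a b i j = Some s -> s \in A) ->
  (forall b k, \sum_a \sum_i (B a b i k == None) = Z) ->
  (forall s, s \in A -> \sum_c occ (B c.1 c.2) s = r) ->
  blackburn (block_array B) ->
  is_PDA_on Z A (block_array B) /\ regular_on r A (block_array B).
Proof.
move=> dg_gt0 r_gt0 BA Bstars Bocc BB; split=> [|s sA].
  split=> // [k l s|l|s sA].
  - have [a [i ->]] := block_indexP k; have [b [j ->]] := block_indexP l.
    by rewrite block_arrayE => /BA.
  - by have [b [j ->]] := block_indexP l; rewrite stars_block_array.
  - by apply: occ_gt0; rewrite occ_block_array Bocc.
by rewrite occ_block_array Bocc.
Qed.

End BlockArrays.

(** * Integer sets of labels; the lifting *)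

Lemma image_fset (I : finType) (A : {pred I}) (f : I -> int) :
  {in A &, injective f} ->
  exists2 S : {fset int}, #|` S|%fset = #|A| &
    forall s, s \in S <-> exists2 i, i \in A & s = f i.
Proof.
move=> f_inj; exists [fset s in image f A]%fset => [|s].
  rewrite card_fseq undup_id ?size_image // map_inj_in_uniq ?enum_uniq //.
  by move=> i j; rewrite !mem_enum; exact: f_inj.
rewrite inE /=; split=> [/imageP[i iA ->]|[i iA ->]]; first by exists i.
by apply/imageP; exists i.
Qed.

Lemma card_offdiag (d : nat) :
  #|[pred c : 'I_d * 'I_d | c.1 != c.2]| = d * d.-1.
Proof.
rewrite -sum1_card big_mkcond -(pair_bigA _ (fun a b : 'I_d =>
  if (a, b) \in [pred c : 'I_d * 'I_d | c.1 != c.2] then 1 else 0)) /=.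
rewrite -[d in RHS]card_ord -sum_nat_const; apply: eq_bigr => a _.
rewrite -big_mkcond sum1_card; have := cardC1 a; rewrite card_ord => <-.
by apply: eq_card => b; rewrite !inE eq_sym.
Qed.

(** A column of the lifting meets one member, with [Z] stars, and [d.-1] diagonal arrays with [g.-1]
    stars each. The new labels, one per ordered pair of distinct indices, add [d * d.-1] integers to
    [A]. *)
Lemma lift_regular_PDA (d g r Z : nat) (A : {fset int})
    (P : 'I_d -> array g g) (t : 'I_d -> 'I_d -> int) :
  0 < d * g -> d * r = g ->
  (forall a, is_PDA_on Z A (P a)) -> (forall a, regular_on r A (P a)) ->
  (forall t0, blackburn_family (diag_array g t0) P) -> lift_labels P t ->
  regular_PDA g (d * g) (d * g) (Z + d.-1 * g.-1) (#|` A|%fset + d * d.-1)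
    (lift_array P t).
Proof.
move=> dg_gt0 drg PA Pr Pfam [t_inj t_new].
have /andP[d_gt0 g_gt0] : (0 < d) && (0 < g) by rewrite -muln_gt0.
have [|T cardT T_P] := @image_fset _
    [pred c : 'I_d * 'I_d | c.1 != c.2] (fun c => t c.1 c.2).
  by case=> [a b] [a' b'] /= /eqP ab /eqP ab'; exact: t_inj.
have tA a b : a <> b -> t a b \notin A.
  move=> ab; apply/negP => /(PDA_surj (PA a)).
  exact: t_new.
have disj : [disjoint A & T]%fset.
  apply/fdisjointP => s sA; apply/negP => /T_P[[a b] /eqP ab def_s].
  by move: sA; rewrite def_s (negPf (tA _ _ ab)).
have offdiag_label a b i j s : a != b -> diag_array g (t a b) i j = Some s ->
    [/\ i = j, t a b = s & forall c, ~ occurs (P c) s].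
  move=> /eqP ab /diag_array_Some[-> <-]; split=> // c; exact: t_new.
suff [PDA_L reg_L] : is_PDA_on (Z + d.-1 * g.-1) (A `|` T)%fset (lift_array P t)
    /\ regular_on g (A `|` T)%fset (lift_array P t).
  exists (A `|` T)%fset; split=> //.
  (* The second component is the equality case of the union bound, namely disjointness. *)
  have [_ cardAT] := leq_card_fsetU A T; rewrite disj in cardAT.
  by rewrite (eqP cardAT) cardT card_offdiag.
apply: regular_block_array => // [a b i j s|b k|s|].
- rewrite in_fsetU; case: eqP => [_ /(PDA_entries (PA a))-> //|ab].
  case/diag_array_Some=> _ <-; apply/orP; right.
  by apply/T_P; exists (a, b) => //; apply/eqP.
- rewrite (bigD1 b) //= eqxx -stars_sum (PDA_stars (PA b)); congr (_ + _).
  have := cardC1 b; rewrite card_ord => <-; rewrite -sum_nat_const.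
  by apply: eq_bigr => a /negPf ab; rewrite ab stars_diag_array.
- case/fsetUP=> [sA|/T_P[[a b] ab ->]].
    (* An integer of [A] occurs only in diagonal blocks: [r] times in each block row, hence [d * r]
       times in all. *)
    rewrite -(pair_bigA _ (fun a b =>
      occ (if a == b then P a else diag_array g (t a b)) s)) /=.
    rewrite -[RHS]drg -[d in RHS]card_ord -sum_nat_const.
    apply: eq_bigr => a _; rewrite (bigD1 a) //= eqxx Pr // big1 ?addn0 //.
    move=> b; rewrite eq_sym => /[dup] ab /negPf->; rewrite occ_diag_array.
    case: eqP => [tab|]; last by rewrite muln0.
    by move: (tA a b (elimN eqP ab)); rewrite tab sA.
  (* A new label occurs in no diagonal block, so the sum reduces to the off-diagonal ones, whose
     labels are distinct. *)
  rewrite (bigID [pred c | c.1 != c.2]) /= addnC big1 => [|[a' b']].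
    rewrite add0n -[RHS](@occ_diag_arrays _
      [pred c : 'I_d * 'I_d | c.1 != c.2] g (fun c => t c.1 c.2) (a, b)) //.
      by apply: eq_bigr => c /negPf->.
    by case=> [a1 b1] [a2 b2] /eqP ab1 /eqP ab2; exact: t_inj.
  rewrite negbK => /= /eqP->; rewrite eqxx occ_eq0 //.
  by apply: t_new; apply/eqP.
apply: blackburn_block_array => [a b|a b a' b' i j i' j' s neq].
  by case: eqP => _; [exact: PDA_blackburn (PA a)|exact: blackburn_diag_array].
(* Only two diagonal blocks can share an integer: a mixed pair contradicts the freshness of the
   labels, and off-diagonal blocks with equal labels coincide. *)
have [eab|ab] := eqVneq a b; have [eab'|ab'] := eqVneq a' b'.
- subst b b' => Ps Ps'; have aa' : a <> a' by congruence.
  case: eqP => // _; case: eqP => [e|_]; first by case: aa'.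
  (* The crossing cells lie in two different off-diagonal blocks, so compatibility is used once for
     each of their labels. *)
  split; first by have [] := Pfam (t a a') _ _ aa' _ _ _ _ _ Ps Ps'.
  by have [] := Pfam (t a' a) _ _ aa' _ _ _ _ _ Ps Ps'.
- move=> Ps /(offdiag_label _ _ _ _ _ ab')[_ _ /(_ a)[]].
  by exists i, j.
- move=> /(offdiag_label _ _ _ _ _ ab)[_ _ /(_ a') new Ps'].
  by case: new; exists i', j'.
move=> /(offdiag_label _ _ _ _ _ ab)[_ tab _].
move=> /(offdiag_label _ _ _ _ _ ab')[_ tab' _].
by case: neq; apply: t_inj; [apply/eqP|apply/eqP|congruence].
Qed.

(** * The cyclic family *)

Section CyclicFamily.
Variables d' m : nat.
(** A successor, so that ['I_d] carries addition modulo [d]. *)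
Let d := d'.+1.
Hypothesis m_gt0 : 0 < m.

Definition diag_shift (a : 'I_d) (c : 'I_d * 'I_d) : 'I_d * 'I_d :=
  if c.1 == c.2 then (c.1 - a, c.1 - a)%R else c.

Lemma diag_shift_inj a : injective (diag_shift a).
Proof.
case=> [x y] [x' y']; rewrite /diag_shift /=.
case: eqP => [->|xy]; case: eqP => [->|xy'].
- by move/(congr1 fst)/addIr->.
- by case=> e1 e2; case: xy'; rewrite -e1 -e2.
- by case=> e1 e2; case: xy; rewrite e1 e2.
- by [].
Qed.

(** For two diagonal positions, a common index would cancel and leave [a = b]; two off-diagonal
    positions are equal; mixed cases are impossible. The other inequality needed for compatibility
    comes from exchanging the two sides. *)
Lemma diag_shift_neq a b c c' :
  a <> b -> diag_shift a c = diag_shift b c' -> c.1 <> c'.2.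
Proof.
case: c c' => [x y] [x' y'] ab; rewrite /diag_shift /=.
case: eqP => [_|xy]; case: eqP => [->|xy'].
- by move=> /(congr1 fst) /= + e; rewrite e => /addrI/oppr_inj.
- by case=> e1 e2; case: xy'; rewrite -e1 -e2.
- by case=> e1 e2; case: xy; rewrite e1 e2.
- by case=> _ <-.
Qed.

(** [enum_rank] serves as the injection e; being the same for all [a], it makes the members share
    their integers. *)
Definition shift_label (a : 'I_d) (c : 'I_d * 'I_d) : int :=
  Posz (enum_rank (diag_shift a c)).

Definition shift_array (a : 'I_d) : array (d * m) (d * m) :=
  block_array (fun x y => diag_array m (shift_label a (x, y))).

Lemma shift_label_eq a b c c' :
  shift_label a c = shift_label b c' -> diag_shift a c = diag_shift b c'.
Proof. by case=> /val_inj/enum_rank_inj. Qed.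

Lemma shift_label_inj a : injective (shift_label a).
Proof. by move=> c c' /shift_label_eq/diag_shift_inj. Qed.

(** An integer of the big [diag_array] lies in a diagonal block, whereas [diag_shift_neq] puts both
    crossing cells in off-diagonal blocks. *)
Lemma blackburn_family_shift_array (t : int) :
  blackburn_family (diag_array (d * m) t) shift_array.
Proof.
move=> a b ab k1 k2 l1 l2 s.
have [x1 [i1 ->]] := block_indexP k1; have [y1 [j1 ->]] := block_indexP l1.
have [x2 [i2 ->]] := block_indexP k2; have [y2 [j2 ->]] := block_indexP l2.
rewrite !block_arrayE => /diag_array_Some[_ <-] /diag_array_Some[_].
move/shift_label_eq => e.
split; apply: diag_array_None => /block_index_inj[exy _].
  exact: diag_shift_neq ab (esym e) exy.
exact: diag_shift_neq (nesym ab) e exy.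
Qed.

(** The upper left cell tells the members apart, its label being that of the pair [(- a, - a)]; so
    the family is a set of [d] arrays. *)
Lemma shift_array_inj : injective shift_array.
Proof.
move=> a b eab; pose i : 'I_m := Ordinal m_gt0.
have: shift_array a (block_index (ord0, i)) (block_index (ord0, i)) =
      shift_array b (block_index (ord0, i)) (block_index (ord0, i)).
  by rewrite eab.
rewrite !block_arrayE !diag_arrayE !eqxx => -[/val_inj/enum_rank_inj].
by move/(congr1 fst)/addrI/oppr_inj.
Qed.

Lemma shift_array_PDA : exists2 A : {fset int}, #|` A|%fset = d ^ 2 &
  forall a, is_PDA_on (d * m.-1) A (shift_array a) /\
            regular_on m A (shift_array a).
Proof.
have [|A cardA memA] := @image_fset _ predT (shift_label ord0).
  by move=> c c' _ _; exact: shift_label_inj.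
(* Each [diag_shift a] permutes the block positions, so every member uses exactly the labels of the
   member [ord0]. *)
have label_mem a s : s \in A <-> exists c, s = shift_label a c.
  have surj b c : exists c', diag_shift b c' = c.
    have [h _ hK] := injF_bij (@diag_shift_inj b).
    by exists (h c).
  split=> [/memA[c _ ->]|[c ->]].
    have [c' e] := surj a (diag_shift ord0 c).
    by exists c'; rewrite /shift_label e.
  apply/memA; have [c' e] := surj ord0 (diag_shift a c).
  by exists c'; rewrite // /shift_label e.
exists A => [|a]; first by rewrite cardA card_prod card_ord.
have dm_gt0 : 0 < d * m by rewrite muln_gt0.
apply: regular_block_array => // [x y i j s|y k|s /(label_mem a)[c ->]|].
- by case/diag_array_Some=> _ <-; apply/(label_mem a); exists (x, y).
- under eq_bigr do rewrite stars_diag_array.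
  by rewrite sum_nat_const card_ord.
- rewrite -[RHS](@occ_diag_arrays _ predT m (shift_label a) c) //; last first.
    by move=> ? ? _ _; exact: shift_label_inj.
  by apply: eq_bigr => -[].
apply: blackburn_block_array => [x y|x y x' y' i j i' j' s neq].
  exact: blackburn_diag_array.
case/diag_array_Some=> _ <- /diag_array_Some[_ /shift_label_inj e].
by case: neq; rewrite e.
Qed.

End CyclicFamily.

Theorem lemma21 (g d : nat) (g_gt0 : 0 < g) (d_dvd_g : d %| g) :
  exists P : 'I_d -> array g g,
    [/\ injective P,
        forall i : 'I_d, regular_PDA (g %/ d) g g (g - d) (d ^ 2) (P i),
        forall t : int, (forall i : 'I_d, ~ occurs (P i) t) ->
          blackburn_family (diag_array g t) P
      & forall t : 'I_d -> 'I_d -> int, lift_labels P t ->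
          regular_PDA g (d * g) (d * g) (d * g + 1 - 2 * d) (d * (2 * d - 1))
            (lift_array P t)].
Proof.
have [m def_g] := dvdnP d_dvd_g; rewrite mulnC in def_g; subst g.
have /andP[d_gt0 m_gt0] : (0 < d) && (0 < m) by rewrite -muln_gt0.
case: d d_gt0 g_gt0 {d_dvd_g} => // d' _ g_gt0.
have [A cardA PA] := shift_array_PDA d' m_gt0.
have stars : d'.+1 * m.-1 = d'.+1 * m - d'.+1 by nia.
exists (@shift_array d' m); split=> [|i|t _|t t_lab].
- exact: shift_array_inj.
- by rewrite mulKn // -stars -cardA; exists A; case: (PA i).
- exact: blackburn_family_shift_array.
have := @lift_regular_PDA _ _ m (d'.+1 * m.-1) A _ t _ erefl
  (fun a => (PA a).1) (fun a => (PA a).2)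
  (@blackburn_family_shift_array d' m) t_lab.
rewrite muln_gt0 g_gt0 cardA => /(_ isT).
(* With g = d m the star count is d (m - 1) + (d - 1) (d m - 1) = d^2 m + 1 - 2 d, which is at least
   (d - 1)^2, so the subtraction of naturals does not truncate. *)
suff [-> ->] : d'.+1 * m.-1 + d'.+1.-1 * (d'.+1 * m).-1 =
    d'.+1 * (d'.+1 * m) + 1 - 2 * d'.+1 /\
  d'.+1 ^ 2 + d'.+1 * d'.+1.-1 = d'.+1 * (2 * d'.+1 - 1) by [].
by case: m m_gt0 {PA stars t t_lab g_gt0} => // m' _; split; nia.
Qed.
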